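(* Fix $\kappa\ge0$. If $(x,p)\in C^1(\mathcal{I},\mathbb{R}^3\times\mathbb{R}^3)$ is a solution of the Hamiltonian system $$\dot x=D_pH(x,p),\qquad \dot p=-D_xH(x,p)$$ on an interval $\mathcal{I}$, then the quantities $$X_i\circ\Phi\circ\Gamma(x(t),p(t)),\qquad i=1,2,3,$$ are invariant (constant in $t$). The three invariants $X_i\circ\Phi\circ\Gamma$ Poisson commute, and so the Hamiltonian system is completely integrable.
   Context: $\mathbb{M}^2$ is the space of real $2\times2$ matrices with inner product $\langle A,B\rangle=\mathrm{tr}(A^\top B)$ and norm $|A|=\langle A,A\rangle^{1/2}$; $\langle\cdot,\cdot\rangle$ also denotes the Euclidean inner product on $\mathbb{R}^n$. Let $$I=\begin{bmatrix}1&0\\0&1\end{bmatrix},\quad Z=\begin{bmatrix}0&-1\\1&0\end{bmatrix},\quad K=\begin{bmatrix}1&0\\0&-1\end{bmatrix},\quad M=\begin{bmatrix}0&1\\1&0\end{bmatrix}.$$ For $A,B\in\mathbb{M}^2$: $X_1(A,B)=\tfrac12|B|^2+\tfrac\kappa2|A|^2$, $X_2(A,B)=\tfrac12\langle ZA-AZ,B\rangle$, $X_3(A,B)=\tfrac12\langle ZA+AZ,B\rangle$. For $x=(x_1,x_2,x_3)\in\mathbb{R}^3$ set $\rho(x)=(2+x_1^2+x_2^2)^{1/2}$ and $$\varphi(x)=\tfrac1{\sqrt2}\left(\rho(x)\cos x_3\,I+\rho(x)\sin x_3\,Z+x_1K+x_2M\right)\in\mathbb{M}^2 .$$ Let $g(x)=D_x\varphi(x)^\top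 D_x\varphi(x)$, the $3\times3$ matrix with entries $g_{ij}(x)=\langle\partial_{x_i}\varphi(x),\partial_{x_j}\varphi(x)\rangle$ (it is invertible). Define $\Phi(x,y)=(\varphi(x),D_x\varphi(x)y)$ and $\Gamma(x,p)=(x,g^{-1}(x)p)$ for $x,y,p\in\mathbb{R}^3$. The Hamiltonian is $$H(x,p)=\tfrac12\langle g^{-1}(x)p,p\rangle+\tfrac\kappa2|\varphi(x)|^2,\qquad (x,p)\in\mathbb{R}^3\times\mathbb{R}^3 .$$ Poisson commutation refers to the canonical Poisson bracket in the variables $(x,p)\in\mathbb{R}^3\times\mathbb{R}^3$. *)

(* Defs.v *)
From HB Require Import structures.
From mathcomp Require Import all_boot all_order all_algebra.
From mathcomp Require Import all_classical all_reals all_analysis.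

Set Implicit Arguments.
Unset Strict Implicit.
Unset Printing Implicit Defensive.
Import Order.TTheory GRing.Theory Num.Theory.
Import numFieldNormedType.Exports.
Local Open Scope classical_set_scope.
Local Open Scope ring_scope.

(* For m = n = 2 this is the inner product of M^2, and for column vectors the
   Euclidean one.  The library's norm `|A| is the sup norm, hence [norm2]. *)
Definition inner (R : realType) (m n : nat) (A B : 'M[R]_(m, n)) : R :=
  \tr (A^T *m B).

Definition norm2 (R : realType) (m n : nat) (A : 'M[R]_(m, n)) : R :=
  Num.sqrt (inner A A).

Section DifferentialCalculus.
Variable R : realType.

(* The limit is taken inside I, so it is one-sided at an endpoint of I. *)
Definition has_derivative_on (V : normedModType R) (I : set R) (f : R -> V)
    (t : R) (df : V) : Prop :=
  (s - t)^-1 *: (f s - f t) @[s --> within I t^'] --> df.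

Definition C1_on (V : normedModType R) (I : set R) (f : R -> V) : Prop :=
  exists df : R -> V,
    (forall t, I t -> has_derivative_on I f t (df t)) /\
    {within I, continuous df}.

(* Class C^k on a finite-dimensional V: all iterated directional derivatives
   up to order k exist, and those of order k are continuous. *)
Fixpoint class_C (V : normedModType R) (k : nat) (f : V -> R) : Prop :=
  match k with
  | 0%N => continuous f
  | k'.+1 => forall v : V, (forall x, derivable f x v) /\ class_C k' ('D_v f)
  end.

Definition smooth (V : normedModType R) (f : V -> R) : Prop :=
  forall k, class_C k f.

End DifferentialCalculus.

Section HamiltonianSystems.
Variables (R : realType) (n : nat).

Local Notation V := 'cV[R]_n.
Local Notation P := ('cV[R]_n * 'cV[R]_n)%type.

Definition basis_vec (i : 'I_n) : V := delta_mx i 0.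

Definition grad_x (F : P -> R) (x p : V) : V :=
  \col_i 'D_(basis_vec i) (fun x' => F (x', p)) x.

Definition grad_p (F : P -> R) (x p : V) : V :=
  \col_i 'D_(basis_vec i) (fun p' => F (x, p')) p.

Definition poisson (F G : P -> R) (z : P) : R :=
  inner (grad_x F z.1 z.2) (grad_p G z.1 z.2)
  - inner (grad_p F z.1 z.2) (grad_x G z.1 z.2).

Definition poisson_commute (F G : P -> R) : Prop :=
  forall z, poisson F G z = 0.

Definition hamiltonian_solution (H : P -> R) (I : set R) (x p : R -> V)
    : Prop :=
  forall t, I t ->
    has_derivative_on I x t (grad_p H (x t) (p t)) /\
    has_derivative_on I p t (- grad_x H (x t) (p t)).

Definition independent_at (F : 'I_n -> P -> R) (z : P) : bool :=
  row_free (row_mx (\matrix_(i < n) (grad_x (F i) z.1 z.2)^T)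
                   (\matrix_(i < n) (grad_p (F i) z.1 z.2)^T)).

(* Liouville's notion, with the n integrals F named explicitly: smooth first
   integrals of H in involution, with linearly independent differentials on an
   open dense subset of the 2n-dimensional phase space. *)
Definition completely_integrable_by (H : P -> R) (F : 'I_n -> P -> R)
    : Prop :=
  [/\ smooth H /\ (forall i, smooth (F i)),
      forall i, poisson_commute (F i) H,
      forall i j, poisson_commute (F i) (F j) &
      exists U : set P,
        [/\ open U, dense U & forall z, U z -> independent_at F z]].

End HamiltonianSystems.

Section AffineMotion.
Variable R : realType.

Definition mx2 (a b c d : R) : 'M[R]_2 :=
  \matrix_(i, j) (if i == 0 then if j == 0 then a else b
                  else if j == 0 then c else d).

Definition mxI : 'M[R]_2 := mx2 1    0
                                0    1.
Definition mxZ : 'M[R]_2 := mx2 0 (- 1)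
                                1    0.
Definition mxK : 'M[R]_2 := mx2 1    0
                                0 (- 1).
Definition mxM : 'M[R]_2 := mx2 0    1
                                1    0.

Definition X1 (kappa : R) (AB : 'M[R]_2 * 'M[R]_2) : R :=
  let: (A, B) := AB in 2^-1 * norm2 B ^+ 2 + kappa / 2 * norm2 A ^+ 2.

Definition X2 (AB : 'M[R]_2 * 'M[R]_2) : R :=
  let: (A, B) := AB in 2^-1 * inner (mxZ *m A - A *m mxZ) B.

Definition X3 (AB : 'M[R]_2 * 'M[R]_2) : R :=
  let: (A, B) := AB in 2^-1 * inner (mxZ *m A + A *m mxZ) B.

(* The indices 0, 1, 2 of 'I_3 stand for 1, 2, 3. *)
Definition X (kappa : R) (i : 'I_3) : 'M[R]_2 * 'M[R]_2 -> R :=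
  match val i with
  | 0%N => X1 kappa
  | 1%N => X2
  | _ => X3
  end.

(* The coordinates x_1, x_2, x_3 are the entries x 0 0, x 1 0, x 2 0. *)
Definition rho (x : 'cV[R]_3) : R := Num.sqrt (2 + x 0 0 ^+ 2 + x 1 0 ^+ 2).

Definition phi (x : 'cV[R]_3) : 'M[R]_2 :=
  (Num.sqrt 2)^-1 *:
    ((rho x * cos (x 2 0)) *: mxI + (rho x * sin (x 2 0)) *: mxZ
     + x 0 0 *: mxK + x 1 0 *: mxM).

Definition g (x : 'cV[R]_3) : 'M[R]_3 :=
  \matrix_(i, j) inner ('D_(basis_vec R i) phi x) ('D_(basis_vec R j) phi x).

Definition Phi (xy : 'cV[R]_3 * 'cV[R]_3) : 'M[R]_2 * 'M[R]_2 :=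
  let: (x, y) := xy in (phi x, 'd phi x y).

Definition Gamma (xp : 'cV[R]_3 * 'cV[R]_3) : 'cV[R]_3 * 'cV[R]_3 :=
  let: (x, p) := xp in (x, invmx (g x) *m p).

Definition hamiltonian (kappa : R) (xp : 'cV[R]_3 * 'cV[R]_3) : R :=
  let: (x, p) := xp in
  2^-1 * inner (invmx (g x) *m p) p + kappa / 2 * norm2 (phi x) ^+ 2.

Definition XPhiGamma (kappa : R) (i : 'I_3) : 'cV[R]_3 * 'cV[R]_3 -> R :=
  X kappa i \o Phi \o Gamma.

End AffineMotion.

(* Main.v *)
From HB Require Import structures.
Require Import Defs.
From mathcomp Require Import all_boot all_order all_algebra ring.
From mathcomp Require Import all_classical all_reals all_analysis.
Import Order.TTheory GRing.Theory Num.Theory.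
Import numFieldNormedType.Exports.
Local Open Scope classical_set_scope.
Local Open Scope ring_scope.

(** The matrices I, Z, K, M divided by the square root of 2 form an orthonormal
    frame of the space of 2 x 2 matrices, and phi(x) has the components
    (rho cos x_3, rho sin x_3, x_1, x_2) in it.  Writing s = x_1^2 + x_2^2, so
    that rho^2 = 2 + s, the metric g splits into a 2 x 2 block in (x_1, x_2) of
    determinant 2 (1 + s) / (2 + s) and the entry 2 + s in x_3, and its inverse
    is explicit ([invmx_g_mul]).  Left and right multiplication by Z act on the
    frame by rotations, whence, in the variables (x, p),
    - X_1 becomes the Hamiltonian H itself, namely ([energy])
      ((2 + s) (p_1^2 + p_2^2) + (x_2 p_1 - x_1 p_2)^2) / (4 (1 + s))
      + p_3^2 / (2 (2 + s)) + kappa (1 + s);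
    - X_2 becomes the angular momentum x_1 p_2 - x_2 p_1;
    - X_3 becomes p_3.
    The function H is invariant under the rotations of the (x_1, x_2)-plane and
    does not depend on x_3, and the last two functions do not involve x_3;
    hence the three functions Poisson commute, which is a computation with
    explicit partial derivatives.

    Conservation along solutions is general ([first_integral]): if F is
    differentiable and Poisson commutes with H, the chain rule gives F a zero
    derivative along a solution in the interior of the time interval, and the
    mean value theorem concludes.

    Smoothness holds because the three functions are rational with denominators
    that do not vanish, a class stable under directional derivatives
    ([rational_smooth]).  The minor of their Jacobian matrix in the columns
    p_1, p_2, p_3 is (x_1 p_1 + x_2 p_2) (2 + s) / (2 (1 + s)), so
    they are independent where x_1 p_1 + x_2 p_2 does not vanish; this set is
    open, and dense because the polynomial is strictly convex along the
    direction that moves x_1 and p_1 at the same speed. *)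

Set Implicit Arguments.
Unset Strict Implicit.
Unset Printing Implicit Defensive.

(** * Pointwise rules of differentiation *)

Section Differentials.
Variable R : realType.
Implicit Types U V W : normedModType R.

Lemma is_diff_linear V W (l : V -> W) (x : V) :
  linear l -> continuous l -> is_diff x l l.
Proof.
move=> ll cl; pose lM := GRing.isLinear.Build _ _ _ _ _ ll.
pose L : {linear V -> W} := HB.pack l lM.
by apply: DiffDef; [exact: (@linear_differentiable _ _ _ L)|exact: (@diff_lin _ _ _ L)].
Qed.

Lemma is_diff_coord m n (A : 'M[R]_(m, n)) i j :
  is_diff A (fun B : 'M[R]_(m, n) => B i j) (fun B => B i j).
Proof.
apply: is_diff_linear; last exact: coord_continuous.
by move=> a B C; rewrite !mxE.
Qed.

Lemma is_diff_comp_real V (f df : V -> R) (h : R -> R) (h' : R) (x : V) :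
  is_diff x f df -> is_derive (f x) 1 h h' ->
  is_diff x (fun z => h (f z)) (fun v => df v * h').
Proof.
move=> fdf hh'; have dh : is_diff (f x) h (fun t => t * h').
  apply: DiffDef; first exact/derivable1_diffP.
  by rewrite deriv1E// derive1E derive_val.
exact: (is_diff_comp fdf dh).
Qed.

Lemma is_diff_scale V W (f df : V -> R) (w : W) (x : V) :
  is_diff x f df -> is_diff x (fun z => f z *: w) (fun v => df v *: w).
Proof.
move=> fdf; apply: DiffDef; first exact: differentiableZl.
by rewrite diffZl// diff_val.
Qed.

Lemma is_diff_is_derive V W (f df : V -> W) (z v : V) :
  is_diff z f df -> is_derive z v f (df v).
Proof.
by move=> d; apply: DeriveDef; [exact: diff_derivable|rewrite deriveE// diff_val].
Qed.

End Differentials.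

Section DirectionalDerivatives.
Variables (R : realType) (V : normedModType R) (z v : V).
Implicit Types (f h : V -> R) (df dh : R).

Lemma is_derive_add f h df dh : is_derive z v f df -> is_derive z v h dh ->
  is_derive z v (fun w => f w + h w) (df + dh).
Proof. exact: is_deriveD. Qed.

Lemma is_derive_sub f h df dh : is_derive z v f df -> is_derive z v h dh ->
  is_derive z v (fun w => f w - h w) (df - dh).
Proof. exact: is_deriveB. Qed.

Lemma is_derive_mul f h df dh : is_derive z v f df -> is_derive z v h dh ->
  is_derive z v (fun w => f w * h w) (f z * dh + h z * df).
Proof. exact: is_deriveM. Qed.

Lemma is_derive_sqr f df : is_derive z v f df ->
  is_derive z v (fun w => f w ^+ 2) (2 * f z * df).
Proof. by move=> d; exact: (is_deriveX 2 d). Qed.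

Lemma is_derive_inv f df : f z != 0 -> is_derive z v f df ->
  is_derive z v (fun w => (f w)^-1) (- (f z) ^- 2 * df).
Proof.
move=> fz d; apply: DeriveDef; first exact: derivableV.
by rewrite deriveV// derive_val.
Qed.

End DirectionalDerivatives.

(** * Rational functions are smooth *)

(** The functions obtained from constants and continuous linear forms by sums,
    products, and inverses of functions without zeros; the last requirement
    makes each of them an everywhere defined regular function. *)
Inductive rational_fun {R : realType} {V : normedModType R} : (V -> R) -> Prop :=
| rational_cst (c : R) : rational_fun (fun=> c)
| rational_linear (l : V -> R) : linear l -> continuous l -> rational_fun l
| rational_add (f h : V -> R) :
    rational_fun f -> rational_fun h -> rational_fun (fun z => f z + h z)
| rational_mul (f h : V -> R) :
    rational_fun f -> rational_fun h -> rational_fun (fun z => f z * h z)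
| rational_inv (f : V -> R) :
    (forall z, f z != 0) -> rational_fun f -> rational_fun (fun z => (f z)^-1).

Section RationalFunctions.
Variables (R : realType) (V : normedModType R).
Implicit Types (f h : V -> R) (x v : V).

Lemma rational_opp f : rational_fun f -> rational_fun (fun z => - f z).
Proof.
move=> rf; under eq_fun do rewrite -mulN1r.
exact: rational_mul (rational_cst _) rf.
Qed.

Lemma rational_exp f n : rational_fun f -> rational_fun (fun z => f z ^+ n).
Proof.
move=> rf; elim: n => [|n ihn]; first exact: rational_cst.
under eq_fun do rewrite exprS.
exact: rational_mul rf ihn.
Qed.

Lemma rational_differentiable f x : rational_fun f -> differentiable f x.
Proof.
elim=> {f} [c|l ll cl|f h _ df _ dh|f h _ df _ dh|f f0 _ df].
- exact: differentiable_cst.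
- by have := is_diff_linear x ll cl.
- exact: differentiableD.
- exact: differentiableM.
- exact: differentiableV.
Qed.

Lemma rational_continuous f : rational_fun f -> continuous f.
Proof.
by move=> rf x; exact/differentiable_continuous/rational_differentiable.
Qed.

Lemma rational_derivable f x v : rational_fun f -> derivable f x v.
Proof. by move=> rf; apply/diff_derivable/rational_differentiable. Qed.

Lemma rational_derive f v : rational_fun f -> rational_fun ('D_v f).
Proof.
elim=> {f} [c|l ll cl|f h rf df rh dh|f h rf df rh dh|f f0 rf df].
- suff -> : 'D_v (fun=> c) = fun=> 0 :> R by exact: rational_cst.
  by apply/funext => x; exact: derive_cst.
- suff -> : 'D_v l = fun=> l v by exact: rational_cst.
  apply/funext => x; have d := is_diff_linear x ll cl.
  by rewrite deriveE// diff_val.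
- suff -> : 'D_v (fun z => f z + h z) = fun z => 'D_v f z + 'D_v h z.
    exact: rational_add.
  by apply/funext => x; apply: deriveD; exact: rational_derivable.
- suff -> : 'D_v (fun z => f z * h z) =
            fun z => f z * 'D_v h z + h z * 'D_v f z.
    by apply: rational_add; exact: rational_mul.
  by apply/funext => x; apply: deriveM; exact: rational_derivable.
- suff -> : 'D_v (fun z => (f z)^-1) = fun z => - (f z)^-1 ^+ 2 * 'D_v f z.
    apply: rational_mul => //; apply/rational_opp/rational_exp.
    exact: rational_inv.
  apply/funext => x; rewrite exprVn.
  by apply: deriveV => //; exact: rational_derivable.
Qed.

Lemma rational_smooth f : rational_fun f -> smooth f.
Proof.
move=> rf k; elim: k f rf => [|k ihk] f rf /=; first exact: rational_continuous.
move=> v; split=> [x|]; first exact: rational_derivable.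
exact/ihk/rational_derive.
Qed.

End RationalFunctions.

(** * Phase space, Poisson bracket and first integrals *)

Section Inner.
Variables (R : realType) (m n : nat).
Implicit Types A B : 'M[R]_(m, n).

Lemma innerE A B : inner A B = \sum_i \sum_j A i j * B i j.
Proof.
rewrite /inner /mxtrace exchange_big /=; apply: eq_bigr => j _.
by rewrite mxE; apply: eq_bigr => i _; rewrite mxE.
Qed.

Lemma innerC A B : inner A B = inner B A.
Proof.
by rewrite !innerE; apply: eq_bigr => i _; apply: eq_bigr => j _; rewrite mulrC.
Qed.

Lemma innerZl k A B : inner (k *: A) B = k * inner A B.
Proof.
rewrite !innerE mulr_sumr; apply: eq_bigr => i _; rewrite mulr_sumr.
by apply: eq_bigr => j _; rewrite mxE mulrA.
Qed.

Lemma innerZr k A B : inner A (k *: B) = k * inner A B.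
Proof. by rewrite innerC innerZl innerC. Qed.

Lemma innerNr A B : inner A (- B) = - inner A B.
Proof. by rewrite -scaleN1r innerZr mulN1r. Qed.

Lemma sqr_norm2 A : norm2 A ^+ 2 = inner A A.
Proof.
rewrite sqr_sqrtr// innerE; apply: sumr_ge0 => i _; apply: sumr_ge0 => j _.
by rewrite -expr2 sqr_ge0.
Qed.

End Inner.

Lemma inner_colE (R : realType) n (a b : 'cV[R]_n) :
  inner a b = \sum_i a i 0 * b i 0.
Proof. by rewrite innerE; apply: eq_bigr => i _; rewrite big_ord1. Qed.

Section PhaseSpace.
Variables (R : realType) (n : nat).
Local Notation V := 'cV[R]_n.
Local Notation P := ('cV[R]_n * 'cV[R]_n)%type.
Implicit Types (F G H : P -> R) (x p a b : V) (z : P).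

Lemma is_diff_fst_coord i z : is_diff z (fun w : P => w.1 i 0) (fun w => w.1 i 0).
Proof.
have d1 : is_diff z (@fst V V) fst by apply: is_diff_linear => // w; exact: cvg_fst.
exact: (is_diff_comp d1 (is_diff_coord _ _ _)).
Qed.

Lemma is_diff_snd_coord i z : is_diff z (fun w : P => w.2 i 0) (fun w => w.2 i 0).
Proof.
have d2 : is_diff z (@snd V V) snd by apply: is_diff_linear => // w; exact: cvg_snd.
exact: (is_diff_comp d2 (is_diff_coord _ _ _)).
Qed.

Lemma rational_fst_coord i : rational_fun (fun w : P => w.1 i 0).
Proof.
apply: rational_linear => [k z w|z]; first by rewrite /= !mxE.
by apply: differentiable_continuous; have d := is_diff_fst_coord i z.
Qed.

Lemma rational_snd_coord i : rational_fun (fun w : P => w.2 i 0).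
Proof.
apply: rational_linear => [k z w|z]; first by rewrite /= !mxE.
by apply: differentiable_continuous; have d := is_diff_snd_coord i z.
Qed.

Lemma grad_xE F x p i :
  grad_x F x p i 0 = 'D_((basis_vec R i, 0) : P) F (x, p).
Proof.
rewrite mxE /derive; set u := fun h => _; set v := fun h => _.
suff -> : u = v by [].
apply/funext => h; rewrite /u /v /=; congr (_ *: (F _ - _)).
by apply: injective_projections; rewrite /= ?scaler0 ?add0r.
Qed.

Lemma grad_pE F x p i :
  grad_p F x p i 0 = 'D_((0, basis_vec R i) : P) F (x, p).
Proof.
rewrite mxE /derive; set u := fun h => _; set v := fun h => _.
suff -> : u = v by [].
apply/funext => h; rewrite /u /v /=; congr (_ *: (F _ - _)).
by apply: injective_projections; rewrite /= ?scaler0 ?add0r.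
Qed.

Lemma poissonE F G x p : poisson F G (x, p) =
  \sum_i ('D_((basis_vec R i, 0) : P) F (x, p) *
          'D_((0, basis_vec R i) : P) G (x, p)
    - 'D_((0, basis_vec R i) : P) F (x, p) *
      'D_((basis_vec R i, 0) : P) G (x, p)).
Proof.
rewrite /poisson !inner_colE -sumrB; apply: eq_bigr => i _.
by rewrite !grad_xE !grad_pE.
Qed.

Lemma poissonC F G z : poisson F G z = - poisson G F z.
Proof. by rewrite /poisson opprB; congr (_ - _); exact: innerC. Qed.

Lemma poisson_commute_refl F : poisson_commute F F.
Proof. by move=> z; rewrite /poisson innerC subrr. Qed.

Lemma poisson_commute_sym F G : poisson_commute F G -> poisson_commute G F.
Proof. by move=> FG z; rewrite poissonC FG oppr0. Qed.

Lemma diff_grad F x p a b : differentiable F (x, p) ->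
  'd F (x, p) (a, b) = inner (grad_x F x p) a + inner (grad_p F x p) b.
Proof.
move=> dF; have colE (c : V) : c = \sum_i c i 0 *: basis_vec R i.
  rewrite [LHS]matrix_sum_delta.
  by apply: eq_bigr => i _; rewrite big_ord1.
have -> : (a, b) = \sum_i (a i 0 *: ((basis_vec R i, 0) : P)) +
    \sum_i (b i 0 *: ((0, basis_vec R i) : P)).
  apply: injective_projections; rewrite /=.
    rewrite !raddf_sum /= [X in _ + X]big1 ?addr0 => [|i _]; last exact: scaler0.
    exact: colE.
  rewrite !raddf_sum /= [X in X + _]big1 ?add0r => [|i _]; last exact: scaler0.
  exact: colE.
rewrite linearD !linear_sum !inner_colE; congr (_ + _); apply: eq_bigr => i _.
- by rewrite linearZ /= -deriveE// grad_xE mulrC.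
- by rewrite linearZ /= -deriveE// grad_pE mulrC.
Qed.

End PhaseSpace.

Section Conservation.
Variable R : realType.

(** In the interior of I the limit taken inside I is the two-sided one. *)
Lemma has_derivative_on_is_derive (V : normedModType R) (I : set R) (f : R -> V)
    (t : R) (df : V) :
  (I°) t -> has_derivative_on I f t df -> is_derive t 1 f df.
Proof.
rewrite /has_derivative_on => It fdf.
have {}fdf : (s - t)^-1 *: (f s - f t) @[s --> t^'] --> df.
  apply: cvg_trans fdf; apply: cvg_app => A.
  change ((\forall s \near within I t^', A s) -> \forall s \near t^', A s).
  rewrite !near_withinE; apply: filterS2 It => s Is + st.
  by apply.
have cvgdf : h^-1 *: (f (h *: 1 + t) - f t) @[h --> 0^'] --> df.
  apply/cvgrPdist_lt => e e0; move/cvgrPdist_lt : fdf => /(_ _ e0).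
  rewrite !near_withinE => /nbhs_ballP[d /= d0 H].
  apply/nbhs_ballP; exists d => //= h; rewrite /ball /= sub0r normrN => hd h0.
  have := H (h *: 1 + t); rewrite /ball /= scaler1 addrK; apply.
    by rewrite opprD addrCA subrr addr0 normrN.
  by rewrite -subr_eq0 addrK.
apply: DeriveDef; first by apply/cvg_ex; exists df.
by apply/cvg_lim => //; exact: norm_hausdorff.
Qed.

Lemma has_derivative_on_cvg (V : normedModType R) (I : set R) (f : R -> V)
    (t : R) (df : V) :
  has_derivative_on I f t df -> f s @[s --> within I (nbhs t)] --> f t.
Proof.
rewrite /has_derivative_on => fdf.
have h : (f t + (s - t) *: ((s - t)^-1 *: (f s - f t))) @[s --> within I t^']
    --> f t + 0 *: df.
  apply: cvgD; first exact: cvg_cst.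
  apply: cvgZ => //; apply: cvg_trans (cvg_app _ (@cvg_within _ _ _ I)) _.
  apply: cvg_trans (cvg_app _ (@cvg_within _ _ _ _)) _.
  rewrite -(subrr t); apply: cvgB; last exact: cvg_cst.
  exact: cvg_id.
rewrite scale0r addr0 in h.
apply/cvgrPdist_lt => e e0; move/cvgrPdist_lt : h => /(_ _ e0).
rewrite !near_withinE; apply: filterS => s H Is.
have [->|st] := eqVneq s t; first by rewrite subrr normr0.
have := H st Is.
by rewrite scalerA divff ?subr_eq0// scale1r [f t + (_ - _)]addrC subrK.
Qed.

Variable n : nat.
Local Notation P := ('cV[R]_n * 'cV[R]_n)%type.

Lemma first_integral (F H : P -> R) (I : interval R) (x p : R -> 'cV[R]_n) :
  (forall z, differentiable F z) -> poisson_commute F H ->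
  hamiltonian_solution H [set` I] x p ->
  forall s t, s \in I -> t \in I -> F (x s, p s) = F (x t, p t).
Proof.
move=> dF FH sol.
suff lt_const s t : s < t -> s \in I -> t \in I ->
    F (x s, p s) = F (x t, p t).
  move=> s t sI tI; have [st|ts|->//] := ltgtP s t; first exact: lt_const.
  by apply/esym/lt_const.
move=> st sI tI; set f := fun u => F (x u, p u).
have subI u : u \in `[s, t] -> u \in I.
  by move=> ust; apply: (interval_is_interval sI tI).
have df u : u \in `]s, t[ -> is_derive u 1 f 0.
  move=> ust.
  have Iu : ([set` I]°) u.
    apply: (@filterS _ _ _ [set` `]s, t[]).
      by move=> v /= vst; apply/subI/subset_itv_oo_cc.
    exact: near_in_itvoo.
  have [dx dp] := sol u (subI _ (subset_itv_oo_cc ust)).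
  have {}dx := has_derivative_on_is_derive Iu dx.
  have {}dp := has_derivative_on_is_derive Iu dp.
  have Dx : differentiable x u by apply/derivable1_diffP.
  have Dp : differentiable p u by apply/derivable1_diffP.
  have Dz : differentiable (fun v => (x v, p v)) u.
    exact: differentiable_pair.
  have Df : differentiable f u by apply: differentiable_comp.
  apply: DeriveDef; first exact/derivable1_diffP.
  have Ex : 'd x u (1 : R) = grad_p H (x u) (p u) :> 'cV[R]_n.
    by rewrite -deriveE// derive_val.
  have Ep : 'd p u (1 : R) = - grad_x H (x u) (p u) :> 'cV[R]_n.
    by rewrite -deriveE// derive_val.
  rewrite deriveE// [f]/(F \o (fun v => (x v, p v))) (diff_comp Dz (dF _)) /=.
  rewrite (diff_pair Dx Dp) /= diff_grad//.
  have := FH (x u, p u); rewrite /poisson /= => <-; congr (_ + _).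
    by rewrite Ex.
  by rewrite Ep innerNr.
have cf : {within `[s, t], continuous f}.
  apply/subspace_continuousP => u /= ust.
  have [dx dp] := sol u (subI _ ust).
  have cF := differentiable_continuous (dF (x u, p u)).
  have cz : (x v, p v) @[v --> within [set` I] (nbhs u)] --> (x u, p u).
    have cx := has_derivative_on_cvg dx.
    have cp := has_derivative_on_cvg dp.
    exact: (cvg_pair cx cp).
  apply: cvg_trans (cvg_comp (fun v => (x v, p v)) F cz cF).
  rewrite [X in _ `=>` X](_ : _ = f v @[v --> within [set` I] (nbhs u)])//.
  by apply: cvg_app; apply: within_subset => v /subI.
have [c _ /eqP] := MVT st df cf.
by rewrite mul0r subr_eq0 => /eqP.
Qed.

End Conservation.

(** * The orthonormal frame of the space of 2 x 2 matrices *)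

Section Frame.
Variable R : realType.
Implicit Types a b c d k : R.

Lemma add_mx2 a b c d a' b' c' d' :
  mx2 a b c d + mx2 a' b' c' d' = mx2 (a + a') (b + b') (c + c') (d + d').
Proof. by apply/matrixP => i j; rewrite !mxE; do 2 case: ifP => _. Qed.

Lemma opp_mx2 a b c d : - mx2 a b c d = mx2 (- a) (- b) (- c) (- d).
Proof. by apply/matrixP => i j; rewrite !mxE; do 2 case: ifP => _. Qed.

Lemma scale_mx2 k a b c d :
  k *: mx2 a b c d = mx2 (k * a) (k * b) (k * c) (k * d).
Proof. by apply/matrixP => i j; rewrite !mxE; do 2 case: ifP => _. Qed.

Lemma mul_mx2 a b c d a' b' c' d' :
  mx2 a b c d *m mx2 a' b' c' d' =
  mx2 (a * a' + b * c') (a * b' + b * d') (c * a' + d * c') (c * b' + d * d').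
Proof.
apply/matrixP => i j; rewrite mxE 2!big_ord_recl big_ord0 addr0 !mxE /=.
by do 2 case: ifP => _.
Qed.

Lemma inner_mx2 a b c d a' b' c' d' :
  inner (mx2 a b c d) (mx2 a' b' c' d') = a * a' + b * b' + c * c' + d * d'.
Proof. by rewrite innerE !(big_ord_recl, big_ord0) !mxE /= !addr0 !addrA. Qed.

(** The matrix with components a, b, c, d in the frame obtained from I, Z, K, M
    by normalization. *)
Definition frame a b c d : 'M[R]_2 :=
  (Num.sqrt 2)^-1 *: (a *: mxI R + b *: mxZ R + c *: mxK R + d *: mxM R).

Lemma frameE a b c d :
  frame a b c d = (Num.sqrt 2)^-1 *: mx2 (a + c) (d - b) (b + d) (a - c).
Proof.
rewrite /frame /mxI /mxZ /mxK /mxM !(scale_mx2, add_mx2).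
by congr mx2; ring.
Qed.

Lemma inner_frame a b c d a' b' c' d' :
  inner (frame a b c d) (frame a' b' c' d') = a * a' + b * b' + c * c' + d * d'.
Proof.
rewrite !frameE innerZl innerZr inner_mx2 mulrA -expr2 exprVn sqr_sqrtr//.
by field.
Qed.

Lemma commutator_frame a b c d :
  mxZ R *m frame a b c d - frame a b c d *m mxZ R = 2 *: frame 0 0 (- d) c.
Proof.
rewrite !frameE /mxZ !scale_mx2 !mul_mx2 opp_mx2 add_mx2.
by congr mx2; ring.
Qed.

Lemma anticommutator_frame a b c d :
  mxZ R *m frame a b c d + frame a b c d *m mxZ R = 2 *: frame (- b) a 0 0.
Proof.
rewrite !frameE /mxZ !scale_mx2 !mul_mx2 add_mx2.
by congr mx2; ring.
Qed.

Lemma X2_frame a b c d a' b' c' d' :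
  X2 (frame a b c d, frame a' b' c' d') = c * d' - d * c'.
Proof. by rewrite /X2 commutator_frame innerZl inner_frame; field. Qed.

Lemma X3_frame a b c d a' b' c' d' :
  X3 (frame a b c d, frame a' b' c' d') = a * b' - b * a'.
Proof. by rewrite /X3 anticommutator_frame innerZl inner_frame; field. Qed.

End Frame.

(** * The parametrization phi and its metric *)

Lemma ord3P (Q : 'I_3 -> Prop) : Q 0 -> Q 1 -> Q 2 -> forall i, Q i.
Proof.
move=> Q0 Q1 Q2 [[|[|[|//]]] h].
- by rewrite (_ : Ordinal h = 0)//; apply/val_inj.
- by rewrite (_ : Ordinal h = 1)//; apply/val_inj.
- by rewrite (_ : Ordinal h = 2)//; apply/val_inj.
Qed.

Lemma sum3E (R : realType) (f : 'I_3 -> R) : \sum_i f i = f 0 + f 1 + f 2.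
Proof.
rewrite !big_ord_recl big_ord0 addr0 addrA.
by congr (f _ + f _ + f _); exact/val_inj.
Qed.

Section Metric.
Variable R : realType.
Local Notation V := 'cV[R]_3.
Implicit Types x p u v : V.

(** The squared distance of x to the third axis. *)
Definition rsq x : R := x 0 0 ^+ 2 + x 1 0 ^+ 2.

Lemma rsq_ge0 x : 0 <= rsq x.
Proof. by rewrite addr_ge0 ?sqr_ge0. Qed.

Lemma addr_rsq_neq0 x : (2 + rsq x != 0) && (1 + rsq x != 0).
Proof. by rewrite !gt_eqF// ltr_wpDr// rsq_ge0. Qed.

Lemma sqr_rho x : rho x ^+ 2 = 2 + rsq x.
Proof. by rewrite sqr_sqrtr -addrA// addr_ge0// rsq_ge0. Qed.

Lemma rho_gt0 x : 0 < rho x.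
Proof. by rewrite sqrtr_gt0 -addrA ltr_wpDr// rsq_ge0. Qed.

(** The differential of [rho] at x. *)
Definition drho x v : R := (x 0 0 * v 0 0 + x 1 0 * v 1 0) / rho x.

Lemma is_diff_rho x : is_diff x (@rho R) (drho x).
Proof.
have rx := rho_gt0 x.
have d0 := is_diff_coord x 0 0; have d1 := is_diff_coord x 1 0.
have sx : 0 < 2 + x 0 0 ^+ 2 + x 1 0 ^+ 2 by rewrite -sqrtr_gt0.
have ds := is_derive1_sqrt sx.
have dq := is_diffD (is_diffD (is_diff_cst (2 : R) x) (is_diffX 1 d0))
  (is_diffX 1 d1).
apply: is_diff_eq (is_diff_comp_real dq ds) _.
apply/funext => v; rewrite /drho -/(rho x) /=.
rewrite -[X in X / _]/(0 + 2 * x 0 0 * v 0 0 + 2 * x 1 0 * v 1 0).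
by field; rewrite gt_eqF.
Qed.

(** The differential of [phi] at x. *)
Definition dphi x v : 'M[R]_2 :=
  frame (drho x v * cos (x 2 0) - rho x * sin (x 2 0) * v 2 0)
        (drho x v * sin (x 2 0) + rho x * cos (x 2 0) * v 2 0)
        (v 0 0) (v 1 0).

Lemma phiE x :
  phi x = frame (rho x * cos (x 2 0)) (rho x * sin (x 2 0)) (x 0 0) (x 1 0).
Proof. by []. Qed.

Lemma is_diff_phi x : is_diff x (@phi R) (dphi x).
Proof.
have dr := is_diff_rho x; have di i := is_diff_coord x i 0.
have dc := is_diff_comp_real (di 2) (is_derive_cos _).
have ds := is_diff_comp_real (di 2) (is_derive_sin _).
have d := is_diffZ (Num.sqrt 2)^-1 (is_diffD (is_diffD (is_diffD
    (is_diff_scale (mxI R) (is_diffM dr dc))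
    (is_diff_scale (mxZ R) (is_diffM dr ds)))
   (is_diff_scale (mxK R) (di 0))) (is_diff_scale (mxM R) (di 1))).
apply: is_diff_eq d _; apply/funext => v.
rewrite -[LHS]/(frame
   (rho x * (v 2 0 * - sin (x 2 0)) + cos (x 2 0) * drho x v)
   (rho x * (v 2 0 * cos (x 2 0)) + sin (x 2 0) * drho x v) (v 0 0) (v 1 0)).
by rewrite /dphi; congr (frame _ _ _ _); ring.
Qed.

Lemma diff_phi x v : 'd (@phi R) x v = dphi x v.
Proof. by have d := is_diff_phi x; rewrite diff_val. Qed.

Lemma derive_phi x v : 'D_v (@phi R) x = dphi x v.
Proof. by have d := is_diff_phi x; rewrite deriveE// diff_val. Qed.

Lemma inner_dphi x u v :
  inner (dphi x u) (dphi x v) =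
  (x 0 0 * u 0 0 + x 1 0 * u 1 0) * (x 0 0 * v 0 0 + x 1 0 * v 1 0) / (2 + rsq x)
  + u 0 0 * v 0 0 + u 1 0 * v 1 0 + (2 + rsq x) * (u 2 0 * v 2 0).
Proof.
rewrite /dphi inner_frame /drho -sqr_rho.
have r0 := rho_gt0 x.
move: (cos2Dsin2 (x 2 0)).
move: (rho x) r0 (cos _) (sin _) => r r0 c s cs.
have sE : c ^+ 2 = 1 - s ^+ 2 by rewrite -cs addrK.
by field: sE; rewrite gt_eqF.
Qed.

Lemma gE x i j : g x i j = inner (dphi x (basis_vec R i)) (dphi x (basis_vec R j)).
Proof. by rewrite mxE !derive_phi. Qed.

(** The velocity that corresponds to the momentum p at the point x, that is, the
    product of the inverse of the metric by p, in closed form. *)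
Definition velocity x p : V :=
  \col_i (if i == 0 then
      ((2 + rsq x + x 1 0 ^+ 2) * p 0 0 - x 0 0 * x 1 0 * p 1 0)
        / (2 * (1 + rsq x))
    else if i == 1 then
      ((2 + rsq x + x 0 0 ^+ 2) * p 1 0 - x 0 0 * x 1 0 * p 0 0)
        / (2 * (1 + rsq x))
    else p 2 0 / (2 + rsq x)).

Lemma g_mul_velocity x p : g x *m velocity x p = p.
Proof.
have /andP[q0 q1] := addr_rsq_neq0 x; rewrite /rsq in q0 q1.
apply/matrixP => i j; rewrite (ord1 j) mxE sum3E !gE !inner_dphi !mxE /=.
by move: i; apply: ord3P; rewrite /= /rsq; field; rewrite q0 q1.
Qed.

Lemma invmx_g_mul x p : invmx (g x) *m p = velocity x p.
Proof.
(* the columns of the inverse of g are the velocities of the basis vectors *)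
pose G := \matrix_(i, j) velocity x (basis_vec R j) i 0.
have /mulmx1_unit[ug _] : g x *m G = 1%:M.
  apply/matrixP => i j.
  transitivity ((g x *m velocity x (basis_vec R j)) i 0).
    by rewrite !mxE; apply: eq_bigr => k _; rewrite [G _ _]mxE.
  by rewrite g_mul_velocity !mxE eqxx andbT.
by rewrite -[p in LHS](g_mul_velocity x) mulKmx.
Qed.

Lemma norm2_phi x : norm2 (phi x) ^+ 2 = 2 * (1 + rsq x).
Proof.
rewrite sqr_norm2 phiE inner_frame.
transitivity (rho x ^+ 2 * (cos (x 2 0) ^+ 2 + sin (x 2 0) ^+ 2) + rsq x).
  by rewrite /rsq; ring.
by rewrite cos2Dsin2 sqr_rho; ring.
Qed.

End Metric.

(** * Closed forms of the three invariants *)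

Section ClosedForms.
Variables (R : realType) (kappa : R).
Local Notation P := ('cV[R]_3 * 'cV[R]_3)%type.
Implicit Types z v : P.

(** The Hamiltonian in closed form; [rsq] is unfolded and inverses stand for
    quotients, so that the expression is visibly a rational function. *)
Definition energy z : R :=
  2^-1 * (((2 + (z.1 0 0 ^+ 2 + z.1 1 0 ^+ 2)) * (z.2 0 0 ^+ 2 + z.2 1 0 ^+ 2) +
           (z.1 1 0 * z.2 0 0 - z.1 0 0 * z.2 1 0) ^+ 2)
            * (2 * (1 + (z.1 0 0 ^+ 2 + z.1 1 0 ^+ 2)))^-1
          + z.2 2 0 ^+ 2 * (2 + (z.1 0 0 ^+ 2 + z.1 1 0 ^+ 2))^-1)
  + kappa * (1 + (z.1 0 0 ^+ 2 + z.1 1 0 ^+ 2)).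

(** The angular momentum about the third axis. *)
Definition angular_momentum z : R := z.1 0 0 * z.2 1 0 - z.1 1 0 * z.2 0 0.

(** The momentum conjugate to the cyclic variable x_3. *)
Definition third_momentum z : R := z.2 2 0.

Lemma hamiltonianE : hamiltonian kappa = energy.
Proof.
apply/funext => -[x p]; have := addr_rsq_neq0 x.
rewrite /hamiltonian invmx_g_mul norm2_phi inner_colE sum3E !mxE /= /energy /rsq.
by move=> /andP[q0 q1] /=; field; rewrite q0 q1.
Qed.

Lemma XPhiGamma0E : XPhiGamma kappa 0 = energy.
Proof.
apply/funext => -[x p]; have := addr_rsq_neq0 x.
rewrite /XPhiGamma /X /X1 /= invmx_g_mul norm2_phi diff_phi sqr_norm2.
rewrite inner_dphi !mxE /= /energy /rsq.
by move=> /andP[q0 q1] /=; field; rewrite q0 q1.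
Qed.

Lemma XPhiGamma1E : XPhiGamma kappa 1 = angular_momentum.
Proof.
apply/funext => -[x p]; have := addr_rsq_neq0 x.
rewrite -[LHS]/(X2 (phi x, 'd (@phi R) x (invmx (g x) *m p))).
rewrite invmx_g_mul diff_phi X2_frame !mxE /= /angular_momentum /rsq.
by move=> /andP[_ q1] /=; field; rewrite q1.
Qed.

Lemma XPhiGamma2E : XPhiGamma kappa 2 = third_momentum.
Proof.
apply/funext => -[x p]; have /andP[q0 _] := addr_rsq_neq0 x.
rewrite -[LHS]/(X3 (phi x, 'd (@phi R) x (invmx (g x) *m p))).
rewrite invmx_g_mul diff_phi X3_frame; set y := velocity x p.
transitivity ((cos (x 2 0) ^+ 2 + sin (x 2 0) ^+ 2) * rho x ^+ 2 * y 2 0).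
  by ring.
by rewrite cos2Dsin2 sqr_rho mxE /= /third_momentum /=; field.
Qed.

Lemma rational_energy : rational_fun energy.
Proof.
have rx := @rational_fst_coord R 3; have rp := @rational_snd_coord R 3.
have rs : rational_fun (fun z : P => z.1 0 0 ^+ 2 + z.1 1 0 ^+ 2).
  by apply: rational_add; exact: rational_exp.
have rc c : rational_fun (fun z : P => c + (z.1 0 0 ^+ 2 + z.1 1 0 ^+ 2)).
  by apply: rational_add => //; exact: rational_cst.
apply: rational_add; last by apply: rational_mul => //; exact: rational_cst.
apply: rational_mul; first exact: rational_cst.
apply: rational_add; apply: rational_mul.
- apply: rational_add.
    by apply: rational_mul => //; apply: rational_add; exact: rational_exp.
  apply: rational_exp; apply: rational_add; first exact: rational_mul.
  by apply: rational_opp; exact: rational_mul.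
- apply: rational_inv; last by apply: rational_mul => //; exact: rational_cst.
  move=> z; have /andP[_ q1] := addr_rsq_neq0 z.1.
  by rewrite mulf_neq0// pnatr_eq0.
- exact: rational_exp.
- by apply: rational_inv => // z; have /andP[] := addr_rsq_neq0 z.1.
Qed.

Lemma rational_angular_momentum : rational_fun angular_momentum.
Proof.
have rx := @rational_fst_coord R 3; have rp := @rational_snd_coord R 3.
apply: rational_add; first exact: rational_mul.
by apply: rational_opp; exact: rational_mul.
Qed.

Lemma rational_XPhiGamma i : rational_fun (XPhiGamma kappa i).
Proof.
move: i; apply: ord3P; rewrite ?XPhiGamma0E ?XPhiGamma1E ?XPhiGamma2E.
- exact: rational_energy.
- exact: rational_angular_momentum.
- exact: rational_snd_coord.
Qed.

Lemma derive_angular_momentum z v : 'D_v angular_momentum z =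
  z.1 0 0 * v.2 1 0 + v.1 0 0 * z.2 1 0 - z.1 1 0 * v.2 0 0 - v.1 1 0 * z.2 0 0.
Proof.
have dx i := is_diff_is_derive v (is_diff_fst_coord i z).
have dp i := is_diff_is_derive v (is_diff_snd_coord i z).
have e := is_derive_sub (is_derive_mul (dx 0) (dp 1))
                        (is_derive_mul (dx 1) (dp 0)).
by rewrite [LHS](@derive_val _ _ _ _ _ _ _ e); ring.
Qed.

Lemma derive_third_momentum z v : 'D_v third_momentum z = v.2 2 0.
Proof.
have e := is_diff_is_derive v (is_diff_snd_coord 2 z).
by rewrite [LHS](@derive_val _ _ _ _ _ _ _ e).
Qed.

Lemma derive_energy z v :
  let s := z.1 0 0 ^+ 2 + z.1 1 0 ^+ 2 in
  let ds := 2 * (z.1 0 0 * v.1 0 0 + z.1 1 0 * v.1 1 0) in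
  let L := z.1 1 0 * z.2 0 0 - z.1 0 0 * z.2 1 0 in
  let dL := z.1 1 0 * v.2 0 0 + v.1 1 0 * z.2 0 0
            - (z.1 0 0 * v.2 1 0 + v.1 0 0 * z.2 1 0) in
  'D_v energy z =
    2^-1 * (((2 + s) * (2 * (z.2 0 0 * v.2 0 0 + z.2 1 0 * v.2 1 0))
             + ds * (z.2 0 0 ^+ 2 + z.2 1 0 ^+ 2) + 2 * L * dL) / (2 * (1 + s))
      - ((2 + s) * (z.2 0 0 ^+ 2 + z.2 1 0 ^+ 2) + L ^+ 2) * (2 * ds) /
        (2 * (1 + s)) ^+ 2
      + 2 * z.2 2 0 * v.2 2 0 / (2 + s) - z.2 2 0 ^+ 2 * ds / (2 + s) ^+ 2)
    + kappa * ds.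
Proof.
move=> s ds L dL.
have dx i := is_diff_is_derive v (is_diff_fst_coord i z).
have dp i := is_diff_is_derive v (is_diff_snd_coord i z).
have dc (c : R) : is_derive z v (fun=> c) 0 by exact: is_derive_cst.
have /andP[q0 q1] := addr_rsq_neq0 z.1.
have q1' : 2 * (1 + rsq z.1) != 0 by rewrite mulf_neq0 ?pnatr_eq0.
have es := is_derive_add (is_derive_sqr (dx 0)) (is_derive_sqr (dx 1)).
have ep := is_derive_add (is_derive_sqr (dp 0)) (is_derive_sqr (dp 1)).
have e1 := is_derive_add (dc 1) es.
have e2 := is_derive_add (dc 2) es.
have eL := is_derive_sub (is_derive_mul (dx 1) (dp 0))
                         (is_derive_mul (dx 0) (dp 1)).
have eN := is_derive_add (is_derive_mul e2 ep) (is_derive_sqr eL).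
have eV1 := is_derive_inv (f := fun w : P => 2 * (1 + rsq w.1)) q1'
  (is_derive_mul (dc 2) e1).
have eV2 := is_derive_inv (f := fun w : P => 2 + rsq w.1) q0 e2.
have e := is_derive_add (is_derive_mul (dc 2^-1)
    (is_derive_add (is_derive_mul eN eV1)
                   (is_derive_mul (is_derive_sqr (dp 2)) eV2)))
  (is_derive_mul (dc kappa) e1).
rewrite [LHS](@derive_val _ _ _ _ _ _ _ e).
rewrite /rsq in q0 q1 *.
by rewrite /dL /ds /L /s /=; field; rewrite q0 q1.
Qed.

End ClosedForms.

(** * Involution and independence *)

Section Integrability.
Variables (R : realType) (kappa : R).
Local Notation P := ('cV[R]_3 * 'cV[R]_3)%type.

Lemma poisson_energy_angular_momentum :
  poisson_commute (energy kappa) (@angular_momentum R).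
Proof.
move=> [x p]; have /andP[q0 q1] := addr_rsq_neq0 x; rewrite /rsq in q0 q1.
rewrite poissonE sum3E !derive_energy !derive_angular_momentum !mxE /=.
by field; rewrite q0 q1.
Qed.

Lemma poisson_energy_third_momentum :
  poisson_commute (energy kappa) (@third_momentum R).
Proof.
move=> [x p]; have /andP[q0 q1] := addr_rsq_neq0 x; rewrite /rsq in q0 q1.
rewrite poissonE sum3E !derive_energy !derive_third_momentum !mxE /=.
by field; rewrite q0 q1.
Qed.

Lemma poisson_angular_momentum_third_momentum :
  poisson_commute (@angular_momentum R) (@third_momentum R).
Proof.
move=> [x p].
rewrite poissonE sum3E !derive_angular_momentum !derive_third_momentum !mxE /=.
by ring.
Qed.

Lemma XPhiGamma_involution (i j : 'I_3) :
  poisson_commute (XPhiGamma kappa i) (XPhiGamma kappa j).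
Proof.
have EL := poisson_energy_angular_momentum.
have EM := poisson_energy_third_momentum.
have LM := poisson_angular_momentum_third_momentum.
move: i j; apply: ord3P; apply: ord3P;
  rewrite ?XPhiGamma0E ?XPhiGamma1E ?XPhiGamma2E.
- exact: poisson_commute_refl.
- exact: EL.
- exact: EM.
- exact: poisson_commute_sym EL.
- exact: poisson_commute_refl.
- exact: LM.
- exact: poisson_commute_sym EM.
- exact: poisson_commute_sym LM.
- exact: poisson_commute_refl.
Qed.

(** The function x_1 p_1 + x_2 p_2, whose zeros contain the points where the
    differentials of the three invariants are dependent. *)
Definition radial (z : P) : R := z.1 0 0 * z.2 0 0 + z.1 1 0 * z.2 1 0.

Lemma independent_radial (z : P) :
  radial z != 0 -> independent_at (XPhiGamma kappa) z.
Proof.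
case: z => x p; rewrite /radial /= => xp0; apply: inj_row_free => v.
set A := row_mx _ _ => vA0.
have {}vA0 j : \sum_i v 0 i * A i j = 0.
  by have := congr1 (fun M : 'rV_(3 + 3) => M 0 j) vA0; rewrite !mxE.
(* only the partial derivatives with respect to the momenta are needed *)
have H k : v 0 0 * 'D_((0, basis_vec R k) : P) (energy kappa) (x, p)
  + v 0 1 * 'D_((0, basis_vec R k) : P) (@angular_momentum R) (x, p)
  + v 0 2 * 'D_((0, basis_vec R k) : P) (@third_momentum R) (x, p) = 0.
  have AE i : A i (rshift 3 k) =
      'D_((0, basis_vec R k) : P) (XPhiGamma kappa i) (x, p).
    by rewrite row_mxEr mxE mxE grad_pE.
  by rewrite -(vA0 (rshift 3 k)) sum3E !AE XPhiGamma0E XPhiGamma1E XPhiGamma2E.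
have /andP[q0 q1] := addr_rsq_neq0 x.
have v0 : v 0 0 = 0.
  (* x_1 times the first relation plus x_2 times the second eliminates the
     differential of the angular momentum *)
  have : v 0 0 * ((x 0 0 * p 0 0 + x 1 0 * p 1 0) * (2 + rsq x)
                  / (2 * (1 + rsq x))) = 0.
    transitivity (x 0 0 * 0 + x 1 0 * 0 : R); last by rewrite !mulr0 addr0.
    rewrite -{1}(H 0) -(H 1).
    rewrite !derive_energy !derive_angular_momentum !derive_third_momentum.
    by rewrite !mxE /= /rsq in q0 q1 *; field; rewrite q0 q1.
  move/eqP; rewrite mulf_eq0 => /orP[/eqP//|].
  by rewrite !(mulf_eq0, invr_eq0) (negbTE xp0) (negbTE q0) (negbTE q1) pnatr_eq0.
have H0 : x 1 0 * v 0 1 = 0.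
  rewrite -[RHS]oppr0 -(H 0) v0 derive_angular_momentum derive_third_momentum.
  by rewrite !mxE /=; ring.
have H1 : x 0 0 * v 0 1 = 0.
  rewrite -(H 1) v0 derive_angular_momentum derive_third_momentum.
  by rewrite !mxE /=; ring.
have v1 : v 0 1 = 0.
  apply/eqP; apply: contraNT xp0 => v1.
  move/eqP: H0; move/eqP: H1; rewrite !mulf_eq0 !(negbTE v1) !orbF.
  by move=> /eqP-> /eqP->; rewrite !mul0r addr0.
have v2 : v 0 2 = 0.
  rewrite -(H 2) v0 v1 derive_angular_momentum derive_third_momentum.
  by rewrite !mxE /=; ring.
apply/matrixP => i j; rewrite (ord1 i) mxE; move: j.
exact: ord3P.
Qed.

Lemma open_radial : open [set z | radial z != 0].
Proof.
have rx := @rational_fst_coord R 3; have rp := @rational_snd_coord R 3.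
have cr : continuous radial.
  by apply: rational_continuous; apply: rational_add; exact: rational_mul.
apply: (@open_comp _ _ radial [set t | t != 0]) => [z _|]; first exact: cr.
exact: open_neq.
Qed.

Lemma dense_radial : dense [set z | radial z != 0].
Proof.
move=> O [z Oz] oO.
have [z0|z0] := eqVneq (radial z) 0; last by exists z.
pose w : P := (basis_vec R 0, basis_vec R 0).
have cO : {for (0 : R), continuous (fun t : R => z + t *: w)}.
  by apply: cvgD; [exact: cvg_cst|apply: cvgZr_tmp; exact: cvg_id].
have : \forall t \near (0 : R), O (z + t *: w).
  by apply: cO; apply: open_nbhs_nbhs; rewrite scale0r addr0.
move=> /nbhs_ballP[e /= e0 He].
(* radial (z + t *: w) = radial z + t * b + t ^+ 2, which is positive when
   radial z = 0 and the sign of t is that of b *)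
pose b := z.1 0 0 + z.2 0 0.
pose t := if 0 <= b then e / 2 else - (e / 2).
have e2 : 0 < e / 2 by rewrite divr_gt0.
have tb : 0 <= t * b.
  rewrite /t; case: ifPn => [b0|]; first by rewrite mulr_ge0// ltW.
  by rewrite -ltNge mulNr oppr_ge0 => b0; rewrite mulr_ge0_le0// ltW.
have te : `|t| = e / 2.
  by rewrite /t; case: ifP => _; rewrite ?normrN gtr0_norm.
exists (z + t *: w); split => /=.
  by apply: He; rewrite /ball /= sub0r normrN te ltr_pdivrMr// ltr_pMr// ltr1n.
have -> : radial (z + t *: w) = radial z + t * b + `|t| ^+ 2.
  by rewrite real_normK ?num_real// /radial /w /b /= !mxE /=; ring.
by rewrite z0 add0r gt_eqF// ltr_wpDl// te exprn_gt0.
Qed.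

End Integrability.

Theorem theorem6p7 (R : realType) (kappa : R) (hkappa : 0 <= kappa) :
  [/\ forall (I : interval R) (x p : R -> 'cV[R]_3),
        C1_on [set` I] (fun t => (x t, p t)) ->
        hamiltonian_solution (hamiltonian kappa) [set` I] x p ->
        forall (i : 'I_3) (s t : R), s \in I -> t \in I ->
          XPhiGamma kappa i (x s, p s) = XPhiGamma kappa i (x t, p t),
      forall i j : 'I_3,
        poisson_commute (XPhiGamma kappa i) (XPhiGamma kappa j) &
      completely_integrable_by (hamiltonian kappa) (XPhiGamma kappa)].
Proof.
have HE : hamiltonian kappa = XPhiGamma kappa 0.
  by rewrite hamiltonianE XPhiGamma0E.
have comm := XPhiGamma_involution kappa.
have rat := rational_XPhiGamma kappa.
split=> [I x p _ sol i s t sI tI|//|].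
  apply: (first_integral _ _ sol) => //; last by rewrite HE.
  by move=> z; exact: rational_differentiable.
split=> //.
- split=> [|i]; last exact: rational_smooth.
  by rewrite HE; exact: rational_smooth.
- by rewrite HE.
- exists [set z | radial z != 0]; split.
  + exact: open_radial.
  + exact: dense_radial.
  + by move=> z; exact: independent_radial.
Qed.
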